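(* For all $h\in\mathbb{N}$ and $x\in\mathbb{R}$ such that $x>h\ge 2$, we have $$1<\theta(x,h)<e,$$ where $e$ is the base of the natural logarithm.
   Context: For $m\in\mathbb{N}$ and $x\in\mathbb{R}$, $\binom{x}{m}=\frac{x(x-1)\cdots(x-m+1)}{m!}$. For a positive integer $h$ and a real number $x\ge h$, $$\theta(x,h)=\frac{h}{x}\binom{x}{h}^{1/h}.$$ *)

(* Defs.v *)
From mathcomp Require Import all_boot all_order all_algebra.
From mathcomp Require Import reals sequences exp.

Set Implicit Arguments.
Unset Strict Implicit.
Unset Printing Implicit Defensive.

Import Order.TTheory GRing.Theory Num.Theory.

Local Open Scope ring_scope.

Definition gbinom (R : realType) (x : R) (m : nat) : R :=
  (\prod_(i < m) (x - i%:R)) / (m`!)%:R.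

(* [powR] is the real [h]-th root on nonnegative arguments, and [gbinom x h] is
   positive when [x >= h]; [theta] is intended for [0 < h <= x] only. *)
Definition theta (R : realType) (x : R) (h : nat) : R :=
  h%:R / x * gbinom x h `^ (1 / h%:R).

(* Main.v *)
(** Raise to the power h: theta(x,h)^h = h^h/h! * prod_{i<h} (1 - i/x).  The
    product lies between prod_{i<h} (1 - i/h) = h!/h^h and 1, so the two bounds
    reduce to comparing factors and to h^h < e^h h!. *)

Require Import Defs.
From mathcomp Require Import all_boot all_order all_algebra.
From mathcomp Require Import reals sequences exp.

Import Order.TTheory GRing.Theory Num.Theory.

Local Open Scope ring_scope.

(** Dividing by [n%:R ^+ n], this is the [n]-th power of [1 + 1/n <= exp (1/n)]. *)
Lemma natrS_expr_le (R : realType) (n : nat) :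
  (0 < n)%N -> n.+1%:R ^+ n <= expR 1 * n%:R ^+ n :> R.
Proof.
move=> n0; have nR : n%:R != 0 :> R by rewrite pnatr_eq0 -lt0n.
have -> : expR 1 = expR n%:R^-1 ^+ n :> R by rewrite -expRM_natl divff.
rewrite -exprMn lerXn2r ?nnegrE ?ler0n ?mulr_ge0 ?expR_ge0 //.
have -> : n.+1%:R = (1 + n%:R^-1) * n%:R :> R.
  by rewrite mulrDl mul1r mulVf // natr1.
by rewrite ler_wpM2r // expR_ge1Dx.
Qed.

(** Induction from [n = 1], where it reads [1 < e]; at [n = 0] both sides equal 1. In the step a
    factor [n.+2] cancels, and the previous lemma pays for the change of base with one factor
    [e]. *)
Lemma natr_expr_lt_expR_fact (R : realType) (n : nat) :
  (0 < n)%N -> n%:R ^+ n < expR 1 ^+ n * n`!%:R :> R.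
Proof.
case: n => // n _; elim: n => [|n IH].
  by rewrite !expr1 mulr1 expR_gt1.
rewrite factS natrM mulrCA exprS ltr_pM2l ?ltr0n //.
apply: le_lt_trans (natrS_expr_le R n.+1 isT) _.
by rewrite [expR 1 ^+ _.+2]exprS -mulrA ltr_pM2l ?expR_gt0.
Qed.

(** With [h!] written as the product of the [h - i], both sides have [h] factors, and
    [x * (h - i) <= h * (x - i)] because [h * i <= x * i]. *)
Lemma expr_fact_lt_prodB (R : realType) (h : nat) (x : R) :
  (2 <= h)%N -> h%:R < x ->
  x ^+ h * h`!%:R < h%:R ^+ h * \prod_(i < h) (x - i%:R).
Proof.
move=> h2 hx; have x0 : 0 < x by apply: le_lt_trans hx.
have h0 : (0 : R) < h%:R by rewrite ltr0n (ltn_trans _ h2).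
rewrite -ffactnn ffact_prod natr_prod.
have constE (y : R) : y ^+ h = \prod_(i < h) y by rewrite prodr_const card_ord.
rewrite !constE -!big_split /= {constE}.
case: h h2 hx h0 => [|[|n]] // _ hx h0.
(* The factors at [i = 0] coincide, so they are cancelled; every remaining index is positive and
   gives a strict inequality, and [2 <= h] ensures that one remains. *)
rewrite !(big_ord_recl n.+1) /= subr0 subn0 [x * _]mulrC ltr_pM2l ?mulr_gt0 //.
apply: ltr_prod => [|i _]; first by apply/hasP; exists ord0; rewrite // mem_index_enum.
rewrite natrB; last exact: ltnW (ltn_ord (lift ord0 i)).
have ile : (bump 0 i)%:R <= n.+2%:R :> R.
  by rewrite ler_nat; exact: ltnW (ltn_ord (lift ord0 i)).
rewrite mulr_ge0 ?subr_ge0 ?(ltW x0) //=.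
by rewrite !mulrBr [x * n.+2%:R]mulrC ltrD2l ltrN2 ltr_pM2r ?ltr0n.
Qed.

Lemma prodB_le_expr (R : realType) (h : nat) (x : R) :
  h%:R <= x -> 0 <= \prod_(i < h) (x - i%:R) <= x ^+ h.
Proof.
move=> hx.
have ix (i : 'I_h) : i%:R <= x.
  by apply: le_trans hx; rewrite ler_nat ltnW.
rewrite prodr_ge0 => [|i _]; last by rewrite subr_ge0.
rewrite -[in x ^+ _](card_ord h) -prodr_const ler_prod // => i _.
by rewrite subr_ge0 ix gerBl ler0n.
Qed.

Lemma theta_expr (R : realType) (h : nat) (x : R) :
  (0 < h)%N -> h%:R <= x ->
  theta x h ^+ h =
  (h%:R ^+ h * \prod_(i < h) (x - i%:R)) / (x ^+ h * h`!%:R).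
Proof.
move=> h0 hx; have /andP[p0 _] := prodB_le_expr R h x hx.
rewrite /theta exprMn -[(_ `^ _) ^+ _]powR_mulrn ?powR_ge0 // -powRrM.
(* The exponent collapses to 1, and [powRr1] returns the base only because it is nonnegative, which
   is what [p0] provides. *)
rewrite mul1r mulVf ?pnatr_eq0 -?lt0n // powRr1 ?divr_ge0 //.
by rewrite expr_div_n /gbinom mulf_div.
Qed.

Theorem proposition5p1 (R : realType) (h : nat) (x : R)
  (h_ge2 : (2 <= h)%N) (h_lt_x : h%:R < x) :
  1 < theta x h < expR 1.
Proof.
have h0 : (0 < h)%N by apply: ltn_trans h_ge2.
have x0 : 0 < x by apply: le_lt_trans h_lt_x.
have theta0 : 0 <= theta x h by rewrite mulr_ge0 ?powR_ge0 ?divr_ge0 ?(ltW x0).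
have f0 : 0 < h`!%:R :> R by rewrite ltr0n fact_gt0.
have den0 : 0 < x ^+ h * h`!%:R by rewrite mulr_gt0 ?exprn_gt0.
rewrite -(ltr_pXn2r h0) ?nnegrE // -[X in _ && X](ltr_pXn2r h0) ?nnegrE ?expR_ge0 //.
rewrite theta_expr ?ltW // expr1n ltr_pdivlMr // mul1r expr_fact_lt_prodB //=.
rewrite ltr_pdivrMr // mulrCA.
have /andP[_ px] := prodB_le_expr R h x (ltW h_lt_x).
(* Bounding the product by [x ^+ h] is not strict; strictness comes from [h^h < e^h * h!]. *)
apply: (@le_lt_trans _ _ (h%:R ^+ h * x ^+ h)).
  by rewrite ler_wpM2l ?exprn_ge0.
by rewrite mulrC ltr_pM2l ?exprn_gt0 // natr_expr_lt_expR_fact.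
Qed.
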